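(* Let $K_1, K_2$ be compact (Hausdorff) spaces and let $G$ be a compact (Hausdorff topological) group such that both $K_1$ and $K_2$ admit continuous surjections onto $G$. Then the Banach space $\mathcal C(K_1\times K_2)$ contains a complemented subspace isometric to $\mathcal C(G)$.
   Context: For a compact space $K$, $\mathcal C(K)$ denotes the Banach space of continuous real-valued functions on $K$ with the supremum norm. *)

(* Defs.v *)
From HB Require Import structures.
From mathcomp Require Import all_boot all_order all_algebra.
From mathcomp Require Import all_classical all_reals all_analysis.
Set Implicit Arguments. Unset Strict Implicit. Unset Printing Implicit Defensive.
Import Order.TTheory GRing.Theory Num.Theory numFieldNormedType.Exports.
Local Open Scope classical_set_scope.
Local Open Scope ring_scope.

Definition compact_hausdorff (T : topologicalType) : Prop :=
  compact [set: T] /\ hausdorff_space T.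

Definition topological_group (G : topologicalType)
    (mul : G -> G -> G) (inv : G -> G) (one : G) : Prop :=
  [/\ (forall x y z, mul x (mul y z) = mul (mul x y) z),
      (forall x, mul one x = x /\ mul x one = x),
      (forall x, mul (inv x) x = one /\ mul x (inv x) = one),
      continuous (fun p : G * G => mul p.1 p.2)
    & continuous inv].

Definition CK (R : realType) (K : topologicalType) : set (K -> R) :=
  [set f : K -> R | continuous f].
Arguments CK : clear implicits.

Definition supnorm (R : realType) (K : Type) (f : K -> R) : R :=
  sup (range (fun x => `|f x|)).

Definition linear_on (R : realType) (A B : Type) (D : set (A -> R))
    (T : (A -> R) -> (B -> R)) : Prop :=
  forall (a : R) f g, D f -> D g -> T (a *: f + g) = a *: T f + T g.

Definition subspace_CK (R : realType) (K : topologicalType) (Y : set (K -> R)) : Prop :=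
  Y `<=` CK R K /\ Y 0 /\ (forall (a : R) f g, Y f -> Y g -> Y (a *: f + g)).

Definition complemented_CK (R : realType) (K : topologicalType) (Y : set (K -> R)) : Prop :=
  subspace_CK Y /\
  exists P : (K -> R) -> (K -> R),
    [/\ linear_on (CK R K) P,
        (forall f, CK R K f -> Y (P f)),
        (forall y, Y y -> P y = y)
      & exists M : R, forall f, CK R K f -> supnorm (P f) <= M * supnorm f].

Definition isometric_CK (R : realType) (G K : topologicalType) (Y : set (K -> R)) : Prop :=
  exists T : (G -> R) -> (K -> R),
    [/\ linear_on (CK R G) T,
        T @` CK R G = Y,
        {in CK R G &, injective T}
      & forall f, CK R G f -> supnorm (T f) = supnorm f].

(* Main.v *)
(* Write q1, q2 for the surjections. The map f |-> f (q1 x * q2 y) embeds C(G)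
   isometrically in C(K1 * K2). To project onto its image, choose sections s1,
   s2 of q1, q2 (no regularity) and average H (s, t) = h (s1 s, s2 t), for
   s, t in G, over the fibres {(s, t) | st = g}, as the limit of its Haar
   averages against kernels in g^-1 s t concentrating at the unit. The Haar
   integral is extended to all bounded functions as a generalized limit of
   finite averages, so no measurability is involved. The only real issue is
   continuity in g. For H (s, t) = alpha s * beta t the fibre average is a
   convolution of two bounded functions, which is continuous because alpha can
   be approximated in mean by continuous functions (least squares); by
   compactness of K1 and K2 every h is a uniform limit of finite sums of such
   H. *)
Require Import Defs.
From HB Require Import structures.
From mathcomp Require Import all_boot all_order all_algebra.
From mathcomp Require Import all_classical all_reals all_analysis.
From mathcomp Require Import ring lra.
Set Implicit Arguments.
Unset Strict Implicit.
Unset Printing Implicit Defensive.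
Import Order.TTheory GRing.Theory Num.Theory numFieldNormedType.Exports.
Local Open Scope classical_set_scope.
Local Open Scope ring_scope.

(** * Compactness: finite subcovers and uniformity in a parameter *)

Section compactness.
Context {R : realType}.

(** The near-covering form of compactness, applied to the filter of finite lists ordered by
    inclusion: on [W x], every list containing [x] covers. *)
Lemma compact_finite_subcover (X : topologicalType) (W : X -> set X) :
  compact [set: X] -> (forall x, nbhs x (W x)) ->
  exists l : seq X, forall y, exists2 x, x \in l & W x y.
Proof.
move=> /compact_near_coveringP cX nW.
pose F : set_system (seq X) :=
  filter_from [set: seq X] (fun l => [set l' : seq X | {subset l <= l'}]).
have FF : Filter F.
  apply: filter_from_filter; first by exists [::].
  move=> i j _ _; exists (i ++ j) => // l' sl; split=> x xi; apply: sl;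
  by rewrite mem_cat xi ?orbT.
suff : \forall l \near F, [set: X] `<=` [set y | exists2 x, x \in l & W x y].
  by move=> [l _ /(_ l (fun _ => id)) H]; exists l => y; exact: H.
apply: cX => x _; exists (W x, [set l : seq X | x \in l]); first split => //=.
  by exists [:: x] => // l; apply; rewrite inE.
by move=> [y l] /= [Wxy xl]; exists x.
Qed.

(** A tube argument: for [(y, x')] near [(y0, x)], both [F (y, x')] and [F (y0, x')] are close to
    [F (y0, x)]; compactness then makes the neighbourhood of [y0] independent of [x]. *)
Lemma near_uniform_compact (X Y : topologicalType) (F : Y * X -> R) (y0 : Y) :
  compact [set: X] -> continuous F ->
  forall e, 0 < e -> \forall y \near y0, forall x, `|F (y, x) - F (y0, x)| <= e.
Proof.
move=> /compact_near_coveringP cX cF e e0.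
suff : \forall y \near y0, [set: X] `<=` [set x | `|F (y, x) - F (y0, x)| <= e].
  by apply: filterS => y Hy x; exact: Hy.
apply: cX => x _.
  have e20 : 0 < e / 2 by rewrite divr_gt0.
  move: (cF (y0, x)) => /cvgrPdist_le /(_ _ e20) [[A B] /= [nA nB] AB].
  exists (B, A) => // -[x' y] /= [Bx' Ay].
  have := AB (y, x') (conj Ay Bx').
  have := AB (y0, x') (conj (nbhs_singleton nA) Bx').
  rewrite /=; move=> h1 h2.
  rewrite (_ : _ - _ = (F (y0, x) - F (y0, x')) - (F (y0, x) - F (y, x'))).
    by rewrite (le_trans (ler_normB _ _))// (le_trans (lerD h1 h2))// -splitr.
  by lra.
Qed.

End compactness.

(** * Means on bounded functions, generalized limits and least squares *)

Section means.
Context {R : realType}.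

Definition bounded_map T (u : T -> R) := exists C : R, forall x, `|u x| <= C.

(** In effect a finitely additive probability on all subsets of [T]. Linearity is demanded on
    bounded functions only, where limits along ultrafilters exist. *)
Definition mean T (m : (T -> R) -> R) :=
  [/\ forall a (u v : T -> R), bounded_map u -> bounded_map v ->
        m (fun x => a * u x + v x) = a * m u + m v,
      forall u : T -> R, bounded_map u -> (forall x, 0 <= u x) -> 0 <= m u
    & m (fun=> 1) = 1].

Section bounded.
Context {T : Type}.
Implicit Types u v : T -> R.

Lemma bounded_map_cst c : bounded_map (fun _ : T => c).
Proof. by exists `|c|. Qed.

Lemma bounded_mapM u v : bounded_map u -> bounded_map v ->
  bounded_map (fun x => u x * v x).
Proof.
by move=> [C uC] [D vD]; exists (C * D) => x; rewrite normrM ler_pM.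
Qed.

Lemma bounded_mapD u v : bounded_map u -> bounded_map v ->
  bounded_map (fun x => u x + v x).
Proof.
move=> [C uC] [D vD]; exists (C + D) => x.
by rewrite (le_trans (ler_normD _ _))// lerD.
Qed.

Lemma bounded_mapZ a u : bounded_map u -> bounded_map (fun x => a * u x).
Proof. by apply: bounded_mapM; exact: bounded_map_cst. Qed.

Lemma bounded_mapB u v : bounded_map u -> bounded_map v ->
  bounded_map (fun x => u x - v x).
Proof.
move=> [C uC] [D vD]; exists (C + D) => x.
by rewrite (le_trans (ler_normB _ _))// lerD.
Qed.

End bounded.

Section mean_theory.
Context {T : Type} {m : (T -> R) -> R}.
Hypothesis mm : mean m.
Implicit Types u v : T -> R.

Lemma mean_cst c : m (fun=> c) = c.
Proof.
have [mL _ m1] := mm.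
have m0 : m (fun=> 0) = 0.
  have := mL 1 (fun=> 0) (fun=> 0) (bounded_map_cst _) (bounded_map_cst _).
  rewrite (_ : (fun _ : T => _ + _) = (fun=> 0)); last by apply/funext => x; ring.
  by move=> /eqP; rewrite mul1r eq_sym -subr_eq0 addrK => /eqP.
have := mL c (fun=> 1) (fun=> 0) (bounded_map_cst _) (bounded_map_cst _).
rewrite (_ : (fun _ : T => _ + _) = (fun=> c)); last by apply/funext => x; ring.
by rewrite m1 m0 mulr1 addr0.
Qed.

Lemma meanZ a u : bounded_map u -> m (fun x => a * u x) = a * m u.
Proof.
have [mL _ _] := mm => bu.
rewrite -[RHS]addr0 -[X in _ + X](mean_cst 0) -mL//; last exact: bounded_map_cst.
by congr m; apply/funext => x; rewrite addr0.
Qed.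

Lemma meanD u v : bounded_map u -> bounded_map v ->
  m (fun x => u x + v x) = m u + m v.
Proof.
have [mL _ _] := mm => bu bv; rewrite -[m u]mul1r -mL//.
by congr m; apply/funext => x; rewrite mul1r.
Qed.

Lemma meanB u v : bounded_map u -> bounded_map v ->
  m (fun x => u x - v x) = m u - m v.
Proof.
have [mL _ _] := mm => bu bv; rewrite -[- m v]mulN1r [RHS]addrC -mL//.
by congr m; apply/funext => x; rewrite mulN1r addrC.
Qed.

Lemma mean_le u v : bounded_map u -> bounded_map v ->
  (forall x, u x <= v x) -> m u <= m v.
Proof.
have [_ mP _] := mm => bu bv uv; rewrite -subr_ge0 -meanB//.
by apply: mP => [|x]; [exact: bounded_mapB | rewrite subr_ge0].
Qed.

Lemma mean_le_cst u c : bounded_map u -> (forall x, u x <= c) -> m u <= c.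
Proof. by move=> bu uc; rewrite -[leRHS]mean_cst mean_le//; exact: bounded_map_cst. Qed.

Lemma mean_ge_cst u c : bounded_map u -> (forall x, c <= u x) -> c <= m u.
Proof. by move=> bu uc; rewrite -[leLHS]mean_cst mean_le//; exact: bounded_map_cst. Qed.

Lemma mean_norm_le u v : bounded_map v -> (forall x, `|u x| <= v x) ->
  `|m u| <= m v.
Proof.
move=> bv uv.
have bu : bounded_map u.
  by case: bv => C vC; exists C => x; rewrite (le_trans (uv x))// (le_trans _ (vC x))// ler_norm.
rewrite ler_norml; apply/andP; split.
  rewrite lerNl -[leLHS]mulN1r -meanZ// mean_le//; first exact: bounded_mapZ.
  by move=> x; have := uv x; rewrite ler_norml => /andP[]; lra.
by apply: mean_le => // x; have := uv x; rewrite ler_norml => /andP[].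
Qed.

Lemma mean_norm_le_cst u c : (forall x, `|u x| <= c) -> `|m u| <= c.
Proof.
by move=> uc; rewrite -[leRHS]mean_cst mean_norm_le//; exact: bounded_map_cst.
Qed.

Lemma mean_sum (I : Type) (l : seq I) (u : I -> T -> R) :
  (forall i, bounded_map (u i)) ->
  m (fun x => \sum_(i <- l) u i x) = \sum_(i <- l) m (u i).
Proof.
move=> bu; elim: l => [|i l IH].
  rewrite big_nil -[RHS]mean_cst; congr m; apply/funext => x.
  by rewrite big_nil.
rewrite big_cons -IH -meanD//.
  by congr m; apply/funext => x; rewrite big_cons.
elim: l {IH} => [|j l [C IH]].
  by exists 0 => x; rewrite big_nil normr0.
have [D bD] := bu j; exists (D + C) => x.
by rewrite big_cons (le_trans (ler_normD _ _))// lerD.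
Qed.

End mean_theory.

(** The image filter clusters at a point of the compact segment [[-C, C]], and the image of an
    ultrafilter converges to its cluster points. *)
Lemma ultrafilter_cvg T (F : set_system T) (u : T -> R) :
  UltraFilter F -> bounded_map u -> cvg (u x @[x --> F]).
Proof.
move=> UF [C uC]; have PF := @ultra_proper _ _ UF.
have FC : (u x @[x --> F]) `[- C, C]%classic.
  by apply: nearW => x /=; rewrite in_itv/= -ler_norml.
have [l [_ cl]] := @segment_compact R (- C) C _ _ FC.
apply/cvg_ex; exists l => A nA.
have [//|FnA] := in_ultra_setVsetC (u @^-1` A) UF.
by have [y [/= nAy Ay]] := cl (~` A) A FnA nA.
Qed.

(** The limit along an ultrafilter refining [F]: every bounded function has one, and limits along
    [F] are kept. *)
Lemma mean_along T (F : set_system T) : ProperFilter F ->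
  exists2 m : (T -> R) -> R, mean m &
    forall (u : T -> R) (l : R), u x @[x --> F] --> l -> m u = l.
Proof.
move=> PF; have [U [UU FU]] := ultraFilterLemma PF.
have PU := @ultra_proper _ _ UU.
exists (fun u => lim (u x @[x --> U])) => [|u l ul]; last first.
  by apply: cvg_lim => //; apply: cvg_trans ul => A; exact: FU.
split.
- move=> a u v bu bv; apply: cvg_lim => //.
  by apply: cvgD; [apply: cvgMr|]; exact: ultrafilter_cvg.
- move=> u bu u0; apply: limr_ge; first exact: ultrafilter_cvg.
  by apply: filterS filterT => x.
- by apply: cvg_lim => //; exact: cvg_cst.
Qed.

(* Least squares: phi nearly minimizes m ((alpha - phi)^2) over C(G), so
   alpha - phi is nearly orthogonal to every continuous psi. *)
Lemma mean_approx_continuous (G : topologicalType) (m : (G -> R) -> R)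
    (alpha : G -> R) (e : R) : mean m ->
  (forall f : G -> R, continuous f -> bounded_map f) -> bounded_map alpha ->
  0 < e ->
  exists2 phi : G -> R, continuous phi &
    forall psi C, 0 < C -> continuous psi -> (forall x, `|psi x| <= C) ->
      `|m (fun x => (alpha x - phi x) * psi x)| <= e * C.
Proof.
move=> mm bG ba e0.
pose E := [set m (fun x => (alpha x - phi x) ^+ 2) | phi in [set phi : G -> R | continuous phi]].
have bsq phi : continuous phi -> bounded_map (fun x => (alpha x - phi x) ^+ 2).
  by move=> /bG bphi; apply: bounded_mapM; exact: bounded_mapB.
have lE : has_lbound E.
  exists 0 => _ [phi /= cphi <-]; apply: (mean_ge_cst mm); first exact: bsq.
  by move=> x; exact: sqr_ge0.
have hE : has_inf E.
  split=> //; exists (m (fun x => (alpha x - 0) ^+ 2)), (fun=> 0) => //=.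
  by move=> x; exact: cvg_cst.
have [_ [phi /= cphi <-] phiE] := inf_adherent (exprn_gt0 2 e0) hE.
exists phi => // psi C C0 cpsi psiC.
have bpsi := bG _ cpsi.
have bd : bounded_map (fun x => alpha x - phi x) by apply: bounded_mapB => //; exact: bG.
set X := m _.
(* Comparing [phi] with the competitor [phi + t psi] and expanding the square bounds the cross term
   by the slack [e ^+ 2] in the infimum plus the quadratic term. *)
have key t : 2 * t * X <= e ^+ 2 + t ^+ 2 * C ^+ 2.
  have : inf E <= m (fun x => (alpha x - (phi x + t * psi x)) ^+ 2).
    apply: ge_inf => //; exists (fun x => phi x + t * psi x) => //= x.
    by apply: cvgD; [exact: cphi | apply: cvgMr; exact: cpsi].
  rewrite (_ : (fun x => _) = (fun x => (alpha x - phi x) ^+ 2 +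
     ((- (2 * t)) * ((alpha x - phi x) * psi x) + t ^+ 2 * (psi x) ^+ 2))); last first.
    by apply/funext => x; ring.
  have b1 : bounded_map (fun x => (alpha x - phi x) * psi x) by apply: bounded_mapM.
  have b2 : bounded_map (fun x => psi x ^+ 2) by apply: bounded_mapM.
  rewrite (meanD mm); [|exact: bsq|apply: bounded_mapD; exact: bounded_mapZ].
  rewrite (meanD mm); [|exact: bounded_mapZ..].
  rewrite !(meanZ mm)// -/X.
  have : m (fun x => psi x ^+ 2) <= C ^+ 2.
    apply: (mean_le_cst mm) => // x; have := psiC x.
    by move=> h; rewrite -real_normK ?num_real// lerXn2r// nnegrE// (le_trans _ h).
  move: (m (fun x => psi x ^+ 2)) phiE => q.
  move: (m _) => p h1 h2 h3.
  have := ler_wpM2l (sqr_ge0 t) h2.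
  lra.
(* These values of [t] make both terms on the right equal to [e ^+ 2]; the two signs bound [X] and
   [- X] by [e * C]. *)
have k1 := key (e / C); have k2 := key (- (e / C)).
have eC : e / C * C = e by rewrite divfK// gt_eqF.
have eC2 : (e / C) ^+ 2 * C ^+ 2 = e ^+ 2 by rewrite -exprMn eC.
have eC0 : 0 < e / C by rewrite divr_gt0.
rewrite sqrrN eC2 in k2; rewrite eC2 in k1.
have XE Y : 2 * (e / C) * Y <= e ^+ 2 + e ^+ 2 -> Y <= e * C.
  move=> h; rewrite -(ler_pM2l eC0) (_ : e / C * (e * C) = e ^+ 2); last first.
    by rewrite mulrCA eC.
  by lra.
rewrite ler_norml lerNl; apply/andP; split; apply: XE => //.
by rewrite mulrN -mulNr -mulrN.
Qed.

End means.

(** * Elementary estimates for continuous functions and finite sums *)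

Lemma continuous_bounded (R : realType) (X : topologicalType) (f : X -> R) :
  compact [set: X] -> continuous f -> bounded_map f.
Proof.
move=> cX cf.
have /compact_bounded [M [_ HM]] : compact (f @` [set: X]).
  by apply: continuous_compact => //; exact: continuous_subspaceT.
exists (M + 1) => x; apply: (HM (M + 1)); last by exists x.
by rewrite ltrDl.
Qed.

Lemma continuous_le_dist (R : realType) (X : topologicalType) (f : X -> R) :
  (forall x e, 0 < e -> \forall y \near x, `|f y - f x| <= e) <-> continuous f.
Proof.
split=> [H x|cf x e e0]; first apply/cvgrPdist_le => e e0.
  by apply: filterS (H x e e0) => y; rewrite distrC.
have /cvgrPdist_le/(_ e e0) := cf x.
by apply: filterS => y; rewrite distrC.
Qed.

Lemma sum_seq_le (R : realType) (I : Type) (l : seq I) (g : I -> R) c :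
  (forall i, g i <= c) -> \sum_(i <- l) g i <= (size l)%:R * c.
Proof.
move=> gc; elim: l => [|i l IH]; first by rewrite big_nil mul0r.
by rewrite big_cons /= -natr1 mulrDl mul1r addrC lerD.
Qed.

Lemma sum_seq_le_sub (R : realType) (I : eqType) (l : seq I) (i : I)
    (g : I -> R) c d : i \in l -> (forall j, g j <= c) -> g i <= c - d ->
  \sum_(j <- l) g j <= (size l)%:R * c - d.
Proof.
move=> il gc gi; rewrite (big_rem i)//=.
have := sum_seq_le (rem i l) gc; rewrite size_rem//.
case: l il => // j l _; rewrite [size (_ :: _)]/= -natr1 /=; lra.
Qed.

(** * Averaging operators and the Haar integral on a compact group *)

Section compact_group.
Context {R : realType} {G : topologicalType}.
Context (mul : G -> G -> G) (inv : G -> G) (one : G).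
Hypotheses (chG : compact_hausdorff G) (tG : topological_group mul inv one).
Local Notation "x '*g' y" := (mul x y) (at level 40, left associativity).

Let cG : compact [set: G]. Proof. by case: chG. Qed.

Let mulgA x y z : x *g (y *g z) = x *g y *g z. Proof. by case: tG. Qed.
Let mul1g x : one *g x = x. Proof. by case: tG => _ /(_ x) []. Qed.
Let mulg1 x : x *g one = x. Proof. by case: tG => _ /(_ x) []. Qed.
Let mulVg x : inv x *g x = one. Proof. by case: tG => _ _ /(_ x) []. Qed.
Let mulgV x : x *g inv x = one. Proof. by case: tG => _ _ /(_ x) []. Qed.
Let mulKVg x y : x *g (inv x *g y) = y. Proof. by rewrite mulgA mulgV mul1g. Qed.

Lemma continuous_mulg (X : topologicalType) (f g : X -> G) :
  continuous f -> continuous g -> continuous (fun x => f x *g g x).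
Proof.
move=> cf cg x; have [_ _ _ cm _] := tG.
apply: (@continuous_comp _ _ _ (fun x => (f x, g x)) (fun p => p.1 *g p.2)); last exact: cm.
by apply: cvg_pair; [exact: cf | exact: cg].
Qed.

Let continuous_mull s : continuous (fun x => s *g x).
Proof. by apply: continuous_mulg => x; [exact: cvg_cst | exact: cvg_id]. Qed.

Let continuous_mulr s : continuous (fun x => x *g s).
Proof. by apply: continuous_mulg => x; [exact: cvg_id | exact: cvg_cst]. Qed.

Lemma continuous_lshift (f : G -> R) s : continuous f -> continuous (fun x => f (s *g x)).
Proof. by move=> cf x; apply: continuous_comp; [exact: continuous_mull | exact: cf]. Qed.

Lemma uniform_lshift (f : G -> R) g e : continuous f -> 0 < e ->
  \forall v \near g, forall x, `|f (v *g x) - f (g *g x)| <= e.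
Proof.
move=> cf; apply: (@near_uniform_compact _ _ _ (fun p => f (p.1 *g p.2))) => //.
move=> p; have [_ _ _ cm _] := tG.
by apply: (@continuous_comp _ _ _ (fun p : G * G => p.1 *g p.2)); [exact: cm | exact: cf].
Qed.

(* The model is B f x = sum_i c_i f (x t_i) with c_i >= 0 of sum 1; such an
   operator commutes with left translations. *)
Definition averaging (B : (G -> R) -> (G -> R)) :=
  [/\ forall a f g, B (fun x => a * f x + g x) = (fun x => a * B f x + B g x),
      forall f c, (forall x, f x <= c) -> forall x, B f x <= c
    & forall f s, B (fun x => f (s *g x)) = (fun x => B f (s *g x))].

Lemma averaging_comp B B' : averaging B -> averaging B' -> averaging (B' \o B).
Proof.
move=> [L1 P1 T1] [L2 P2 T2]; split => [a f g|f c fc|f s] /=.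
- by rewrite L1 L2.
- by apply: P2; exact: P1.
- by rewrite T1 T2.
Qed.

Lemma averagingN B f : averaging B -> B (fun x => - f x) = (fun x => - B f x).
Proof.
move=> [L _ _]; have B0 : B (fun=> 0) = fun=> 0.
  have := L (-1) (fun=> 0) (fun=> 0).
  rewrite (_ : (fun _ : G => _ + _) = (fun=> 0)); last by apply/funext => x; ring.
  move=> E; apply/funext => x; have /(congr1 (fun h => h x)) /= := E.
  by move=> ->; ring.
have := L (-1) f (fun=> 0); rewrite B0 => E.
transitivity (B (fun x => -1 * f x + 0)).
  by congr B; apply/funext => x; ring.
by rewrite E; apply/funext => x; ring.
Qed.

Lemma averaging_ge B f c : averaging B -> (forall x, c <= f x) ->
  forall x, c <= B f x.
Proof.
move=> aB fc x; have [_ P _] := aB.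
have := P (fun x => - f x) (- c) _ x; rewrite averagingN// lerN2; apply=> y.
by rewrite lerN2.
Qed.

Lemma averaging_norm_le B f c : averaging B -> (forall x, `|f x| <= c) ->
  forall x, `|B f x| <= c.
Proof.
move=> aB fc x; have [_ P _] := aB; rewrite ler_norml; apply/andP; split.
  by apply: averaging_ge => // y; have := fc y; rewrite ler_norml => /andP[].
by apply: P => y; have := fc y; rewrite ler_norml => /andP[].
Qed.

Lemma averaging_osc B f e : averaging B -> (forall x y, `|f x - f y| <= e) ->
  forall x y, `|B f x - B f y| <= e.
Proof.
move=> aB fe; have [_ P _] := aB.
suff H x y : B f x - B f y <= e.
  by move=> x y; rewrite ler_norml lerNl opprB !H.
have h y' : B f x - e <= f y'.
  rewrite lerBlDl; apply: P => x'.
  by have := fe x' y'; rewrite ler_norml => /andP[]; lra.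
by have := averaging_ge aB h y; lra.
Qed.

(** Since [B] commutes with left translation, the difference to be bounded is [B] applied to the
    corresponding difference for [f]. *)
Lemma averaging_uniform B f v e : averaging B ->
  (forall x, `|f (v *g x) - f x| <= e) -> forall x, `|B f (v *g x) - B f x| <= e.
Proof.
move=> aB fe x; have [L P T] := aB.
have /(congr1 (fun h => h x)) /= := L (-1) f (fun x => f (v *g x)).
rewrite T => E; have := @averaging_norm_le B (fun x => -1 * f x + f (v *g x)) e aB _ x.
rewrite E mulN1r addrC; apply=> y; by rewrite mulN1r addrC.
Qed.

Lemma averaging_continuous B f : averaging B -> continuous f -> continuous (B f).
Proof.
move=> aB cf; apply/continuous_le_dist => x e e0.
have U : nbhs (x *g inv x) [set v | forall z, `|f (v *g z) - f (one *g z)| <= e].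
  by rewrite mulgV; exact: uniform_lshift.
have : \forall y \near x, forall z, `|f ((y *g inv x) *g z) - f (one *g z)| <= e.
  exact: (@continuous_mulr (inv x) x _ U).
apply: filterS => y H.
have := @averaging_uniform B f (y *g inv x) e aB _ x.
rewrite -mulgA mulVg mulg1; apply=> z.
by have := H z; rewrite mul1g.
Qed.

Definition translates_mean (l : seq G) (f : G -> R) (x : G) : R :=
  (size l)%:R^-1 * \sum_(t <- l) f (x *g t).

Lemma translates_mean_averaging l : l != [::] -> averaging (translates_mean l).
Proof.
move=> l0; have sl : 0 < (size l)%:R :> R by rewrite ltr0n lt0n size_eq0.
split => [a f g|f c fc x|f s].
- apply/funext => x; rewrite /translates_mean big_split/= -mulr_sumr mulrDr.
  by rewrite mulrCA.
- by rewrite /translates_mean ler_pdivrMl//; exact: sum_seq_le.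
- by apply/funext => x; rewrite /translates_mean; under eq_bigr do rewrite mulgA.
Qed.

(* B nearly minimizes max (B f). If B f fell by more than e below its maximum at
   z, then averaging over translates that carry z close to every point would
   lower the maximum by an amount depending only on f and e, since B f inherits
   the modulus of continuity of f. *)
Lemma averaging_small_osc f e : continuous f -> 0 < e ->
  exists2 B, averaging B & forall x y, `|B f x - B f y| <= e.
Proof.
move=> cf e0; have [C fC] := continuous_bounded cG cf.
have e20 : 0 < e / 2 by rewrite divr_gt0.
pose V := [set v | forall x, `|f (v *g x) - f (one *g x)| <= e / 2].
have nV : nbhs one V by exact: uniform_lshift.
have [|l lV] := @compact_finite_subcover G (fun t => [set x | V (x *g inv t)]) cG.
  by move=> t; apply: (@continuous_mulr (inv t) t); rewrite mulgV.
have sl : 0 < (size l)%:R :> R.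
  by rewrite ltr0n; have [t + _] := lV one; case: (l).
pose E := [set c : R | exists2 B, averaging B & forall x, B f x <= c].
have lE : has_lbound E.
  exists (- C) => c [B aB Bc]; apply: le_trans (Bc one).
  by apply: averaging_ge => // x; have := fC x; rewrite ler_norml => /andP[].
have hE : has_inf E.
  split=> //; exists C, id => // x.
  by have := fC x; rewrite ler_norml => /andP[].
(* The gain of one more averaging: a single summand out of [size l] drops by [e / 2]. *)
have d0 : 0 < e / 2 / (size l)%:R by rewrite divr_gt0.
have [c [B aB Bc] cE] := inf_adherent d0 hE.
exists B => //.
suff H x z : B f x - B f z <= e.
  by move=> x y; rewrite ler_norml lerNl opprB !H.
rewrite leNgt; apply/negP => osc.
suff /(ge_inf lE) : E (c - e / 2 / (size l)%:R) by move: cE; lra.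
(* At [y], some [t] in [l] has [y t^-1] in [V]. The summand of [t] is [B f] at [(y t^-1) z], within
   [e / 2] of [B f z < c - e], hence below [c - e / 2]. *)
exists (translates_mean [seq inv t *g z | t <- l] \o B) => [|y].
  apply: averaging_comp => //; apply: translates_mean_averaging.
  by case: (l) sl => //; rewrite ltxx.
rewrite /= /translates_mean size_map big_map mulrC ler_pdivrMr// mulrBl divfK ?gt_eqF//.
have [t tl Vt] := lV y.
rewrite [c * _]mulrC; apply: (sum_seq_le_sub tl) => //.
have := @averaging_uniform B f (y *g inv t) (e / 2) aB _ z.
rewrite -mulgA ler_norml => /(_ _)/andP[|_].
  by move=> w; have := Vt w; rewrite mul1g.
by have := Bc x; lra.
Qed.

(** One function at a time: composing with a further averaging operator never enlarges the
    oscillations already made small. *)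
Lemma averaging_small_osc_seq (l : seq (G -> R)) e :
  (forall f, f \in l -> continuous f) -> 0 < e ->
  exists2 B, averaging B & forall f, f \in l -> forall x y, `|B f x - B f y| <= e.
Proof.
move=> + e0; elim: l => [_|f l IH cl]; first by exists id.
have [B aB Bl] : exists2 B, averaging B &
    forall f, f \in l -> forall x y, `|B f x - B f y| <= e.
  by apply: IH => h hl; apply: cl; rewrite inE hl orbT.
have cBf : continuous (B f).
  by apply: averaging_continuous => //; apply: cl; rewrite inE eqxx.
have [B' aB' B'f] := averaging_small_osc cBf e0.
exists (B' \o B); first exact: averaging_comp.
move=> h; rewrite inE => /orP[/eqP -> //|hl] /=.
by apply: averaging_osc => //; exact: Bl.
Qed.

(* The Haar integral on C(G), extended to all bounded functions as a
   generalized limit of averages of right translates: left invariance on C(G)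
   holds because averages that are almost constant are almost left invariant. *)
Lemma haar_mean : exists2 m : (G -> R) -> R, mean m &
  forall f s, continuous f -> m (fun x => f (s *g x)) = m f.
Proof.
(* Averaging operators are filtered by finite lists of continuous functions and tolerances; the
   generalized limit is taken along this filter. *)
pose T := {B | averaging B}.
pose D := [set p : seq (G -> R) * R | (forall f, f \in p.1 -> continuous f) /\ 0 < p.2].
pose S (p : seq (G -> R) * R) := [set B : T | forall f, f \in p.1 ->
  forall x y, `|sval B f x - sval B f y| <= p.2].
have FP : ProperFilter (filter_from D S).
  apply: filter_from_proper; last first.
    move=> [l e] [/= cl e0].
    by have [B aB Bl] := averaging_small_osc_seq cl e0; exists (exist _ B aB).
  apply: filter_from_filter; first by exists ([::], 1); split.
  move=> [l1 e1] [l2 e2] [/= c1 e10] [/= c2 e20].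
  exists (l1 ++ l2, Num.min e1 e2).
    split=> /=; last by rewrite lt_min e10.
    by move=> f; rewrite mem_cat => /orP[/c1|/c2].
  move=> B SB; split=> f /= fl x y.
    by have := SB f _ x y; rewrite /= mem_cat fl le_min => /(_ isT)/andP[].
  by have := SB f _ x y; rewrite /= mem_cat fl orbT le_min => /(_ isT)/andP[].
have [M mM Mlim] := @mean_along R T _ FP.
have bM f x : bounded_map f -> bounded_map (fun B : T => sval B f x).
  by move=> [C fC]; exists C => -[B aB] /=; exact: averaging_norm_le.
exists (fun f => M (fun B => sval B f one)).
  split=> [a f g bf bg|f bf f0|].
  - have [ML _ _] := mM; rewrite -ML; [|exact: bM..].
    by congr M; apply/funext => -[B [/= L _ _]]; rewrite L.
  - have [_ MP _] := mM; apply: MP; first exact: bM.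
    by move=> [B aB] /=; exact: averaging_ge.
  - rewrite -[RHS](mean_cst mM); congr M; apply/funext => -[B aB] /=.
    by apply/eqP; rewrite eq_le averaging_ge// andbT; have [_ P _] := aB; apply: P.
move=> f s cf; have bf := continuous_bounded cG cf.
apply/eqP; rewrite -subr_eq0 -(meanB mM); [|apply: bM..] => //; last first.
  by case: bf => C fC; exists C.
(* For each [B] the difference is [B f s - B f one], at most [e] once [B f] oscillates by at most
   [e]. *)
apply/eqP; apply: Mlim; apply/cvgrPdist_le => e e0.
exists ([:: f], e); first by split=> //= h; rewrite inE => /eqP ->.
move=> [B aB] /= H; have [_ _ ->] := aB.
by rewrite sub0r normrN mulg1; apply: H; rewrite inE.
Qed.

(** * Kernels concentrated at the unit and averages near a fibre *)

Context (m : (G -> R) -> R).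
Hypotheses (mm : mean m)
  (mV : forall f s, continuous f -> m (fun x => f (s *g x)) = m f).

Definition haar_kernel (k : G -> R) :=
  [/\ continuous k, forall x, 0 <= k x & m k = 1].

(** A Urysohn function equal to 1 at the unit and to 0 off [U], divided by its integral. The
    integral is positive: finitely many left translates of the set where the function is at least
    1/2 cover [G], and by invariance each translate of the function has the same integral. *)
Lemma kernel_supported U : nbhs one U ->
  exists2 k, haar_kernel k & forall x, ~ U x -> k x = 0.
Proof.
move=> nU; have [_ hG] := chG.
have : uniform_separator (~` U^°) [set one].
  apply: normal_uniform_separator.
  - exact: compact_normal.
  - by rewrite closedC; exact: open_interior.
  - exact: (accessible_closed_set1 (hausdorff_accessible hG)).
  - by apply/seteqP; split=> // x [/= nx xe]; apply: nx; rewrite xe.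
move=> /(@uniform_separatorP _ R)[f [cf f01 f0 f1]].
have f1' : f one = 1 by apply: f1; exists one.
have fx0 x : ~ U x -> f x = 0.
  by move=> nUx; apply: f0; exists x => // /interior_subset.
have fge0 x : 0 <= f x by have /= := f01 (f x) (ex_intro2 _ _ x I erefl); rewrite in_itv => /andP[].
have bf := continuous_bounded cG cf.
have mf : 0 < m f.
  have nV : nbhs one [set x | 1 / 2 <= f x].
    have /continuous_le_dist/(_ one (1/2)) := cf.
    have h : 0 < 1 / 2 :> R by rewrite divr_gt0.
    move=> /(_ h); apply: filterS => x; rewrite f1' ler_norml /= => /andP[+ _].
    lra.
  have [|l lV] := @compact_finite_subcover G (fun t => [set x | 1 / 2 <= f (inv t *g x)]) cG.
    move=> t; apply: (@continuous_mull (inv t) t [set x | 1 / 2 <= f x]).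
    by rewrite mulVg.
  have bft t : bounded_map (fun x => f (inv t *g x)).
    by case: bf => C fC; exists C.
  have : 1 / 2 <= m (fun x => \sum_(t <- l) f (inv t *g x)).
    apply: (mean_ge_cst mm).
      case: bf => C fC; exists ((size l)%:R * C) => x.
      by rewrite (le_trans (ler_norm_sum _ _ _))//; apply: sum_seq_le => t.
    move=> x; have [t tl ht] := lV x.
    by rewrite (le_trans ht)// (big_rem t)//= lerDl sumr_ge0.
  rewrite (mean_sum mm)// (eq_bigr (fun=> m f)); last by move=> t _; exact: mV.
  have : 0 <= m f by exact: (mean_ge_cst mm).
  rewrite le_eqVlt => /orP[/eqP <-|//].
  by rewrite big1// => h; lra.
exists (fun x => (m f)^-1 * f x).
  split=> [x|x|]; first by apply: cvgMr; exact: cf.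
  - by rewrite mulr_ge0// invr_ge0 ltW.
  - by rewrite (meanZ mm)// mulVf// gt_eqF.
by move=> x nUx; rewrite fx0// mulr0.
Qed.

(* The average of H over a neighbourhood of the fibre {(s, t) | st = g}. *)
Definition near_fibre (k : G -> R) (H : G -> G -> R) (g : G) : R :=
  m (fun s => m (fun t => H s t * k (inv g *g (s *g t)))).

Lemma kernel_lshift k g s : haar_kernel k ->
  m (fun t => k (inv g *g (s *g t))) = 1.
Proof.
move=> [ck _ <-]; rewrite -[RHS](mV (inv g *g s) ck).
by congr m; apply/funext => t; rewrite mulgA.
Qed.

Lemma kernel_lshift_bounded k g s : haar_kernel k ->
  bounded_map (fun t => k (inv g *g (s *g t))).
Proof. by move=> [ck _ _]; have [C kC] := continuous_bounded cG ck; exists C. Qed.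

(** The bound is asked of the product, so that [H] is constrained only where the kernel does not
    vanish. *)
Lemma kernel_integrand_norm_le k (H : G -> G -> R) g s C : haar_kernel k ->
  (forall t, `|H s t * k (inv g *g (s *g t))| <= C * k (inv g *g (s *g t))) ->
  `|m (fun t => H s t * k (inv g *g (s *g t)))| <= C.
Proof.
move=> kk HC; have bk := kernel_lshift_bounded g s kk.
apply: le_trans (mean_norm_le mm _ HC) _; first exact: bounded_mapZ.
by rewrite (meanZ mm)// kernel_lshift// mulr1.
Qed.

Lemma near_fibre_norm_le k H C g : haar_kernel k ->
  (forall s t, `|H s t| <= C) -> `|near_fibre k H g| <= C.
Proof.
move=> kk HC; apply: (mean_norm_le_cst mm) => s.
apply: kernel_integrand_norm_le => // t; have [_ k0 _] := kk.
by rewrite normrM [`|k _|]ger0_norm// ler_wpM2r.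
Qed.

Lemma near_fibre_linear k H H' C C' a g : haar_kernel k ->
  (forall s t, `|H s t| <= C) -> (forall s t, `|H' s t| <= C') ->
  near_fibre k (fun s t => a * H s t + H' s t) g =
  a * near_fibre k H g + near_fibre k H' g.
Proof.
move=> kk HC HC'; have [mL _ _] := mm; have [_ k0 _] := kk.
have b1 D (J : G -> G -> R) : (forall s t, `|J s t| <= D) ->
    bounded_map (fun s => m (fun t => J s t * k (inv g *g (s *g t)))).
  move=> JD; exists D => s; apply: kernel_integrand_norm_le => // t.
  by rewrite normrM [`|k _|]ger0_norm// ler_wpM2r.
have b2 D (J : G -> G -> R) s : (forall s t, `|J s t| <= D) ->
    bounded_map (fun t => J s t * k (inv g *g (s *g t))).
  by move=> JD; apply: bounded_mapM; [exists D | exact: kernel_lshift_bounded].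
rewrite /near_fibre -mL; [|exact: b1 HC|exact: b1 HC'].
congr m; apply/funext => s; rewrite -mL; [|exact: b2 HC|exact: b2 HC'].
by congr m; apply/funext => t; rewrite mulrDl mulrA.
Qed.

(** With [x = g^-1 s t] one has [s t = g x], so [f (s t)] is within [e] of [f g] wherever the kernel
    is nonzero; the constant [f g] is its own average because the kernel has integral 1. *)
Lemma near_fibre_mulg k f g e : haar_kernel k -> continuous f ->
  (forall x, ~ `|f (g *g x) - f g| <= e -> k x = 0) ->
  `|near_fibre k (fun s t => f (s *g t)) g - f g| <= e.
Proof.
move=> kk cf ke; have [_ k0 _] := kk; have [C fC] := continuous_bounded cG cf.
have -> : f g = near_fibre k (fun _ _ => f g) g.
  rewrite /near_fibre -[LHS](mean_cst mm); congr m; apply/funext => s.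
  by rewrite (meanZ mm) ?kernel_lshift ?mulr1//; exact: kernel_lshift_bounded.
rewrite addrC -mulN1r -(@near_fibre_linear _ _ _ `|f g| C)//.
apply: (mean_norm_le_cst mm) => s.
apply: (kernel_integrand_norm_le (H := fun s t => -1 * f g + f (s *g t))) => // t.
have [le_e|gt_e] := pselect (`|f (g *g (inv g *g (s *g t))) - f g| <= e).
  rewrite normrM [`|k _|]ger0_norm// ler_wpM2r//.
  by rewrite mulN1r addrC -[s *g t](mulKVg g).
by rewrite ke// !mulr0 normr0.
Qed.

(* With gam s = m (beta * k (s * _)), the fibre average is
   m (alpha * gam (g^-1 * _)). As |gam| <= sup |beta| for every k, replacing
   alpha by a continuous phi costs little uniformly in k, and left invariance
   then moves the dependence on g from gam to phi. *)
Lemma near_fibre_tensor_equicontinuous (alpha beta : G -> R) g e :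
  bounded_map alpha -> bounded_map beta -> 0 < e ->
  \forall g' \near g, forall k, haar_kernel k ->
    `|near_fibre k (fun s t => alpha s * beta t) g' -
      near_fibre k (fun s t => alpha s * beta t) g| <= e.
Proof.
move=> ba [b0 bb0] e0.
have [b b_gt0 bb] : exists2 b, 0 < b & forall t, `|beta t| <= b.
  exists (b0 + 1) => [|t]; last by rewrite (le_trans (bb0 t))// lerDl.
  by rewrite (le_lt_trans (le_trans (normr_ge0 _) (bb0 one)))// ltrDl.
(* Replacing [alpha] by [phi] costs one third of [e] at [g] and one at [g'], and moving [phi] costs
   the last; dividing by [b] absorbs [|gam| <= b]. *)
have e3 : 0 < e / 3 / b by rewrite !divr_gt0.
have [phi cphi phiP] := mean_approx_continuous mm
  (fun f cf => continuous_bounded cG cf) ba e3.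
have := uniform_lshift g cphi e3.
apply: filterS => g' Hg' k kk; have [ck k0 k1] := kk.
pose gam s := m (fun t => beta t * k (s *g t)).
have bbeta : bounded_map beta by exists b.
have bk s : bounded_map (fun t => k (s *g t)).
  by have [C kC] := continuous_bounded cG ck; exists C.
have gamb s : `|gam s| <= b.
  apply: (le_trans (mean_norm_le mm (v := fun t => b * k (s *g t)) _ _)).
  - exact: bounded_mapZ.
  - by move=> t; rewrite normrM [`|k _|]ger0_norm// ler_wpM2r.
  - by rewrite (meanZ mm)// mV// k1 mulr1.
(* Left invariance of [m] and the approximation [phiP] both concern continuous functions only. As
   [beta] is merely bounded, the continuity comes from the kernel. *)
have cgam : continuous gam.
  apply/continuous_le_dist => s d d0.
  have db : 0 < d / b by rewrite divr_gt0.
  have := uniform_lshift s ck db; apply: filterS => s' Hs'.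
  rewrite /gam -(meanB mm); [|exact: bounded_mapM..].
  apply: (mean_norm_le_cst mm) => t; rewrite -mulrBr normrM.
  by rewrite -(divfK (lt0r_neq0 b_gt0) d) mulrC ler_pM.
have bphi := continuous_bounded cG cphi.
have bgam : bounded_map gam by exists b.
have sh (h : G -> R) u : bounded_map h -> bounded_map (fun s => h (u *g s)).
  by move=> [C hC]; exists C.
have E u : near_fibre k (fun s t => alpha s * beta t) u =
    m (fun s => (alpha s - phi s) * gam (inv u *g s)) +
    m (fun s => phi (u *g s) * gam s).
  have -> : m (fun s => phi (u *g s) * gam s) = m (fun s => phi s * gam (inv u *g s)).
    rewrite -[LHS](mV (inv u)); first by congr m; apply/funext => s; rewrite mulKVg.
    by move=> s; apply: cvgM; [exact: continuous_lshift|exact: cgam].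
  rewrite -(meanD mm); [|by apply: bounded_mapM; [exact: bounded_mapB|exact: sh]
    |by apply: bounded_mapM => //; exact: sh].
  congr m; apply/funext => s; rewrite -mulrDl subrK /gam -(meanZ mm); last exact: bounded_mapM.
  by congr m; apply/funext => t; rewrite -mulrA mulgA.
have S u : `|m (fun s => (alpha s - phi s) * gam (inv u *g s))| <= e / 3.
  rewrite -[leRHS](divfK (lt0r_neq0 b_gt0)); apply: phiP => //.
  exact: continuous_lshift.
have S' : `|m (fun s => phi (g' *g s) * gam s) - m (fun s => phi (g *g s) * gam s)| <= e / 3.
  rewrite -(meanB mm); [|by apply: bounded_mapM => //; exact: sh..].
  apply: (mean_norm_le_cst mm) => s; rewrite -mulrBl normrM.
  by rewrite -[leRHS](divfK (lt0r_neq0 b_gt0)) ler_pM.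
move: (S g) (S g') S'; rewrite !E !ler_norml.
by move=> /andP[? ?] /andP[? ?] /andP[? ?]; apply/andP; split; lra.
Qed.

End compact_group.

(** * Averages over the fibres of multiplication and their continuity *)

Definition bounded_map2 (R : realType) S T (H : S -> T -> R) :=
  exists C : R, forall s t, `|H s t| <= C.

(** [Q] is a generalized limit of near-fibre averages as the kernel supports shrink to the unit.
    Continuity on products survives the limit because the modulus at each [g] is uniform in the
    kernel. *)
Lemma fibre_average (R : realType) (G : topologicalType)
    (mul : G -> G -> G) (inv : G -> G) (one : G) :
  compact_hausdorff G -> topological_group mul inv one ->
  exists Q : (G -> G -> R) -> (G -> R),
  [/\ forall a H H' g, bounded_map2 H -> bounded_map2 H' ->
        Q (fun s t => a * H s t + H' s t) g = a * Q H g + Q H' g,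
      forall H (C : R) g, (forall s t, `|H s t| <= C) -> `|Q H g| <= C,
      forall f, continuous f -> Q (fun s t => f (mul s t)) = f
    & forall alpha beta, bounded_map alpha -> bounded_map beta ->
        continuous (Q (fun s t => alpha s * beta t))].
Proof.
move=> chG tG; have cG : compact [set: G] by case: chG.
have [m mm mV] := @haar_mean R _ _ _ _ chG tG.
(* Kernels are indexed by all sets to keep [k] total; the support condition only concerns
   neighbourhoods of [one]. *)
have /choice[k kP] (U : set G) : exists k : G -> R,
    haar_kernel m k /\ (nbhs one U -> forall x, ~ U x -> k x = 0).
  have [nU|nnU] := pselect (nbhs one U).
    by have [k kk kU] := kernel_supported chG tG mm mV nU; exists k.
  have [k kk _] := kernel_supported chG tG mm mV (@filterT _ (nbhs one) _).
  by exists k.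
have kk U : haar_kernel m (k U) by case: (kP U).
have [M mM Mlim] := @mean_along R (set G) (powerset_filter_from (nbhs one)) _.
have bM H g : bounded_map2 H ->
    bounded_map (fun U => near_fibre mul inv m (k U) H g).
  by move=> [C HC]; exists C => U; exact: (near_fibre_norm_le chG tG mm mV).
exists (fun H g => M (fun U => near_fibre mul inv m (k U) H g)); split.
- move=> a H H' g bH bH'; have [ML _ _] := mM.
  rewrite -ML; [|exact: bM..]; congr M; apply/funext => U.
  by case: bH bH' => C HC [C' HC']; exact: (near_fibre_linear chG tG mm mV a g (kk U) HC HC').
- move=> H C g HC; apply: (mean_norm_le_cst mM) => U.
  exact: (near_fibre_norm_le chG tG mm mV).
- move=> f cf; apply/funext => g; apply: Mlim; apply/cvgrPdist_le => e e0.
  have nU : nbhs one [set x | `|f (mul g x) - f g| <= e].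
    have := continuous_le_dist (fun x => f (mul g x)) => -[_] /(_ (continuous_lshift tG cf)).
    move=> /(_ one e e0); apply: filterS => x.
    by have [_ /(_ g)[_ ->]] := tG.
  near=> V; rewrite distrC; apply: (near_fibre_mulg chG tG mm mV) => // x nx.
  have [_ kV] := kP V; apply: kV => [|Vx].
    by near: V; exact: near_small_set.
  apply: nx; suff : V `<=` [set x | `|f (mul g x) - f g| <= e] by move=> /(_ _ Vx).
  by near: V; exact: small_set_sub.
- move=> alpha beta ba bb; apply/continuous_le_dist => g e e0.
  have := near_fibre_tensor_equicontinuous chG tG mm mV g ba bb e0.
  apply: filterS => g' Hg'.
  have bab : bounded_map2 (fun s t => alpha s * beta t).
    by case: ba bb => C aC [D bD]; exists (C * D) => s t; rewrite normrM ler_pM.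
  rewrite -(meanB mM); [|exact: bM..].
  by apply: (mean_norm_le_cst mM) => U; exact: Hg'.
Unshelve. all: by end_near. Qed.

(** By compactness [K1] has a finite net for the slices [h (x, _)] in sup norm. Moving [x] to its
    net point [r x] turns [h] into a finite sum of products of an indicator in [s] and a slice in
    [t]. Such factors may be discontinuous, but boundedness suffices for the continuity of [Q] on
    products. *)
Lemma fibre_average_continuous (R : realType) (G K1 K2 : topologicalType)
    (Q : (G -> G -> R) -> (G -> R)) (s1 : G -> K1) (s2 : G -> K2)
    (h : K1 * K2 -> R) :
  compact [set: K1] -> compact [set: K2] -> continuous h ->
  (forall a H H' g, bounded_map2 H -> bounded_map2 H' ->
     Q (fun s t => a * H s t + H' s t) g = a * Q H g + Q H' g) ->
  (forall H (C : R) g, (forall s t, `|H s t| <= C) -> `|Q H g| <= C) ->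
  (forall alpha beta, bounded_map alpha -> bounded_map beta ->
     continuous (Q (fun s t => alpha s * beta t))) ->
  continuous (Q (fun s t => h (s1 s, s2 t))).
Proof.
move=> cK1 cK2 ch QL Qn QT.
have [C hC] : bounded_map h.
  by apply: continuous_bounded => //; rewrite -setXTT; exact: compact_setX.
have bh c : bounded_map (fun t => h (c, s2 t)) by exists C.
have cQ (l : seq K1) (r : K1 -> K1) :
    continuous (Q (fun s t => \sum_(c <- l) (r (s1 s) == c)%:R * h (c, s2 t))) /\
    bounded_map2 (fun s t => \sum_(c <- l) (r (s1 s) == c)%:R * h (c, s2 t)).
  have bi c : bounded_map (fun s => (r (s1 s) == c)%:R : R).
    by exists 1 => s; case: eqP => _; rewrite ?normr1 ?normr0.
  elim: l => [|c l [cl bl]].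
    split.
      rewrite (_ : (fun _ _ => _) = (fun _ _ => 0 * 0)).
        by apply: (QT (fun=> 0) (fun=> 0)); exact: bounded_map_cst.
      by apply/funext => s; apply/funext => t; rewrite big_nil mul0r.
    by exists 0 => s t; rewrite big_nil normr0.
  have b1 : bounded_map2 (fun s t => (r (s1 s) == c)%:R * h (c, s2 t)).
    by case: (bi c) (bh c) => A cA [B cB]; exists (A * B) => s t; rewrite normrM ler_pM.
  have E : (fun s t => \sum_(c <- c :: l) (r (s1 s) == c)%:R * h (c, s2 t)) =
      (fun s t => 1 * ((r (s1 s) == c)%:R * h (c, s2 t)) +
        \sum_(c <- l) (r (s1 s) == c)%:R * h (c, s2 t)).
    by apply/funext => s; apply/funext => t; rewrite big_cons mul1r.
  rewrite E; split.
    move=> g; rewrite (_ : Q _ = fun g => 1 * Q (fun s t => (r (s1 s) == c)%:R * h (c, s2 t)) g +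
        Q (fun s t => \sum_(c <- l) (r (s1 s) == c)%:R * h (c, s2 t)) g).
      by apply: cvgD; [apply: cvgMr; exact: QT|exact: cl].
    by apply/funext => g'; exact: QL.
  case: b1 bl => A cA [B cB]; exists (A + B) => s t.
  by rewrite mul1r (le_trans (ler_normD _ _))// lerD.
apply/continuous_le_dist => g e e0.
have e3 : 0 < e / 3 by rewrite divr_gt0.
have [|l lP] := @compact_finite_subcover K1
    (fun x => [set x' | forall y, `|h (x', y) - h (x, y)| <= e / 3]) cK1.
  by move=> x; exact: near_uniform_compact.
have /choice[r rP] x : exists c, c \in l /\ forall y, `|h (x, y) - h (c, y)| <= e / 3.
  by have [c cl hc] := lP x; exists c.
(* Without [undup] a repeated net point would be counted several times. *)
have [cS bS] := cQ (undup l) r.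
set S := (fun s t => _) in cS bS.
have SE s t : S s t = h (r (s1 s), s2 t).
  rewrite /S (bigD1_seq (r (s1 s))) ?undup_uniq ?mem_undup//=; last by case: (rP (s1 s)).
  rewrite eqxx mul1r big1 ?addr0// => c; rewrite eq_sym => /negPf ->.
  by rewrite mul0r.
have QS g' : `|Q (fun s t => h (s1 s, s2 t)) g' - Q S g'| <= e / 3.
  rewrite addrC -mulN1r -QL//; last by exists C.
  apply: Qn => s t; rewrite mulN1r addrC SE.
  by have [_] := rP (s1 s).
have /continuous_le_dist/(_ g _ e3) := cS.
apply: filterS => g'; move: (QS g) (QS g'); rewrite !ler_norml.
by move=> /andP[? ?] /andP[? ?] /andP[? ?]; apply/andP; split; lra.
Qed.

(** * The embedding of [C(G)] and the projection onto its image *)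

Lemma supnorm_norm_le (R : realType) (K : topologicalType) (f : K -> R) x :
  compact [set: K] -> continuous f -> `|f x| <= supnorm f.
Proof.
move=> cK cf; have [C fC] := continuous_bounded cK cf.
by apply: ub_le_sup; [exists C => _ [y _ <-] | exists x].
Qed.

Theorem theorem1p1 (R : realType) (K1 K2 G : topologicalType)
    (mul : G -> G -> G) (inv : G -> G) (one : G) :
  compact_hausdorff K1 -> compact_hausdorff K2 -> compact_hausdorff G ->
  topological_group mul inv one ->
  (exists q1 : K1 -> G, continuous q1 /\ q1 @` [set: K1] = [set: G]) ->
  (exists q2 : K2 -> G, continuous q2 /\ q2 @` [set: K2] = [set: G]) ->
  exists Y : set (K1 * K2 -> R),
    complemented_CK Y /\ isometric_CK G Y.
Proof.
move=> [cK1 _] [cK2 _] chG tG [q1 [cq1 q1T]] [q2 [cq2 q2T]].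
have /choice[s1 s1K] g : exists x, q1 x = g.
  by have [x _ <-] : (q1 @` setT) g by [rewrite q1T]; exists x.
have /choice[s2 s2K] g : exists x, q2 x = g.
  by have [x _ <-] : (q2 @` setT) g by [rewrite q2T]; exists x.
have [_ onem _ _ _] := tG.
have [Q [QL Qn QM QT]] := @fibre_average R _ _ _ _ chG tG.
have cK : compact [set: K1 * K2] by rewrite -setXTT; exact: compact_setX.
pose q (p : K1 * K2) := mul (q1 p.1) (q2 p.2).
have cq : continuous q.
  apply: (continuous_mulg tG) => p.
    by apply: (@continuous_comp _ _ _ fst q1); [exact: cvg_fst|exact: cq1].
  by apply: (@continuous_comp _ _ _ snd q2); [exact: cvg_snd|exact: cq2].
have qs s t : q (s1 s, s2 t) = mul s t by rewrite /q s1K s2K.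
pose T (f : G -> R) := f \o q.
pose Qh (h : K1 * K2 -> R) := Q (fun s t => h (s1 s, s2 t)).
(* [Qh] is a left inverse of [T]: this gives the injectivity of [T] and makes [T \o Qh] the identity
   on the image of [T]. *)
have QhT f : continuous f -> Qh (T f) = f.
  move=> cf; rewrite -[RHS]QM//; congr Q.
  by apply/funext => s; apply/funext => t; rewrite /T /= qs.
have cT f : continuous f -> continuous (T f).
  by move=> cf p; rewrite /T; apply: (@continuous_comp _ _ _ q f); [exact: cq|exact: cf].
have cQh h : continuous h -> continuous (Qh h).
  by move=> ch; apply: (@fibre_average_continuous R G K1 K2 Q s1 s2 h).
have TL (a : R) f g : T (a *: f + g) = a *: T f + T g by [].
exists (T @` CK R G); split; last first.
  exists T; split => //.
    by move=> f g; rewrite !inE => cf cg Tfg; rewrite -(QhT f)// -(QhT g)// Tfg.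
  move=> f cf; rewrite /supnorm; congr sup; apply/seteqP; split=> _ [x _ <-].
    by exists (q x).
  (* This point witnesses that [q] is onto, so [|T f|] and [|f|] have the same range. *)
  by exists (s1 x, s2 one) => //; rewrite /T /= qs (onem x).2.
split.
  split; first by move=> _ [f cf <-]; exact: cT.
  split; first by exists 0 => // x; exact: cvg_cst.
  move=> a _ _ [f cf <-] [g cg <-]; exists (a *: f + g) => // x.
  by apply: cvgD; [apply: cvgZr; exact: cf|exact: cg].
have bh h : continuous h -> bounded_map2 (fun s t => h (s1 s, s2 t)).
  by move=> ch; exists (supnorm h) => s t; exact: supnorm_norm_le.
exists (T \o Qh); split.
- move=> a f g cf cg; rewrite /= -TL; congr T; apply/funext => x.
  by rewrite /Qh [LHS]QL//; exact: bh.
- by move=> h ch; exists (Qh h) => //; exact: cQh.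
- by move=> _ [f cf <-] /=; rewrite QhT.
(* The projection has norm at most 1, since [Q] preserves uniform bounds; the point over
   [(one, one)] shows that the supremum is over a nonempty set. *)
- exists 1 => h ch; rewrite mul1r; apply: ge_sup.
    by exists (`|(T \o Qh) h (s1 one, s2 one)|), (s1 one, s2 one).
  by move=> _ [p _ <-]; apply: Qn => s t; exact: supnorm_norm_le.
Qed.
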